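(* Let $(\mathscr{E},\mathscr{C}_{\mathscr{E}})$ and $(\mathscr{F},\mathscr{C}_{\mathscr{F}})$ be continuous fields of Banach spaces over a topological space $X$, and let $T=(T_x)_{x\in X}$ be a section of closed operators, i.e. each $T_x$ is a closed operator from $\mathscr{E}_x$ to $\mathscr{F}_x$ with domain $D(T_x)\subset\mathscr{E}_x$. The following are equivalent: (i) $T$ is G-continuous, i.e. for each $x\in X$ and each $\zeta\in D(T_x)$ there is $f\in\mathscr{C}(T)$ with $f(x)=\zeta$. (ii) $(\mathscr{D}(T),\mathscr{C}(T))$ is a continuous field of Banach spaces and $T^\flat\in\mathscr{C}^{\mathsf{s}}(\mathscr{D}(T),\mathscr{F})$, i.e. $(x\mapsto T^\flat_xf(x))\in\mathscr{C}_{\mathscr{F}}$ for every $f\in\mathscr{C}(T)$. (iii) $(\mathscr{G}(T),\mathscr{C}(\mathscr{G}(T)))$ is a continuous field of Banach spaces.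
   Context: A section of a family $\mathscr{E}=(\mathscr{E}_x)_{x\in X}$ of vector spaces is a map $f$ on $X$ with $f(x)\in\mathscr{E}_x$; $\Gamma(\mathscr{E})$ is the vector space of sections. $(\mathscr{E},\mathscr{C})$ is a continuous field of Banach spaces over $X$ if every $\mathscr{E}_x$ is a Banach space and $\mathscr{C}\subset\Gamma(\mathscr{E})$ is a linear subspace such that: (a) $x\mapsto\|f(x)\|$ is continuous for all $f\in\mathscr{C}$; (b) (locally uniformly closed) every $g\in\Gamma(\mathscr{E})$ such that for all $x\in X,\varepsilon>0$ there are $f\in\mathscr{C}$ and a neighborhood $U$ of $x$ with $\|g(y)-f(y)\|\le\varepsilon$ for all $y\in U$ belongs to $\mathscr{C}$; (c) (saturated) for all $x\in X,\zeta\in\mathscr{E}_x$ there is $f\in\mathscr{C}$ with $f(x)=\zeta$. For the section $T$ of closed operators: - $\mathscr{D}(T)$ is the field of Banach spaces with fibers $D(T_x)$ with graph norm $\|\zeta\|_{T_x}=(\|\zeta\|^2+\|T_x\zeta\|^2)^{1/2}$; - $T^\flat_x\in\mathscr{L}(\mathscr{D}(T)_x,\mathscr{F}_x)$ is the bounded operator $T^\flat_x\zeta=T_x\zeta$; - $\mathscr{C}(T):=\{f\in\mathscr{C}_{\mathscr{E}} : f(x)\in D(T_x)\ \forall x\in X,\ (x\mapsto T_xf(x))\in\mathscr{C}_{\mathscr{F}}\}$; - $\mathscr{G}(T)$ is the field of Banach spaces whose fiber at $x$ is the graph $\{(\zeta,T_x\zeta):\zeta\in D(T_x)\}\subset\mathscr{E}_x\times\mathscr{F}_x$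 with norm $\|(\zeta,\eta)\|=(\|\zeta\|^2+\|\eta\|^2)^{1/2}$; - $\mathscr{C}(\mathscr{G}(T)):=\Gamma(\mathscr{G}(T))\cap(\mathscr{C}_{\mathscr{E}}\times\mathscr{C}_{\mathscr{F}})$, i.e. the sections $x\mapsto(f(x),h(x))\in\mathscr{G}(T)_x$ with $f\in\mathscr{C}_{\mathscr{E}}$, $h\in\mathscr{C}_{\mathscr{F}}$. *)

(* Defs.v *)
From HB Require Import structures.
From mathcomp Require Import all_boot all_order all_algebra.
From mathcomp Require Import complex ring.
From mathcomp Require Import all_classical all_reals all_analysis.

Set Implicit Arguments.
Unset Strict Implicit.
Unset Printing Implicit Defensive.

Import Order.TTheory GRing.Theory Num.Theory.
Import numFieldNormedType.Exports.

Local Open Scope classical_set_scope.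
Local Open Scope ring_scope.

(* Vector spaces are real or complex. Over R[i] the norm of a normedModType
   takes its values in the nonnegative reals of R[i]. *)
Variant scalars : Type :=
  | RealScalars of realType
  | ComplexScalars of realType.

Definition scalar_field (k : scalars) : numFieldType :=
  match k with
  | RealScalars R => R
  | ComplexScalars R => R[i]
  end.
Coercion scalar_field : scalars >-> numFieldType.

Definition scalar_sqrt (k : scalars) : k -> k :=
  match k return k -> k with
  | RealScalars R => fun a : R => Num.sqrt a
  | ComplexScalars R => fun a : R[i] => sqrtC a
  end.

Definition hypot (k : scalars) (a b : k) : k := scalar_sqrt (a ^+ 2 + b ^+ 2).

Section Hypot.
Variable k : scalars.
Implicit Types a b c d : k.

Lemma scalar_sqrt_ge0 a : 0 <= a -> 0 <= scalar_sqrt a.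
Proof. by case: k a => R a /= a0; rewrite ?sqrtr_ge0 ?sqrtC_ge0. Qed.

Lemma scalar_sqrtK a : 0 <= a -> scalar_sqrt a ^+ 2 = a.
Proof. by case: k a => R a /= a0; rewrite ?sqr_sqrtr ?sqrtCK. Qed.

Lemma hypot_ge0 a b : 0 <= a -> 0 <= b -> 0 <= hypot a b.
Proof. by move=> a0 b0; rewrite scalar_sqrt_ge0// addr_ge0// exprn_ge0. Qed.

Lemma sqr_hypot a b : 0 <= a -> 0 <= b -> hypot a b ^+ 2 = a ^+ 2 + b ^+ 2.
Proof. by move=> a0 b0; rewrite scalar_sqrtK// addr_ge0// exprn_ge0. Qed.

Lemma hypot_eq0 a b : 0 <= a -> 0 <= b -> hypot a b = 0 -> a = 0 /\ b = 0.
Proof.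
move=> a0 b0 h0; have := sqr_hypot a0 b0; rewrite h0 expr0n/= => /esym/eqP.
by rewrite paddr_eq0 ?exprn_ge0// !sqrf_eq0 => /andP[/eqP-> /eqP->].
Qed.

Lemma hypotM c a b : 0 <= c -> 0 <= a -> 0 <= b ->
  hypot (c * a) (c * b) = c * hypot a b.
Proof.
move=> c0 a0 b0; apply/eqP; rewrite -(@eqrXn2 _ 2)//; first last.
- by rewrite mulr_ge0// hypot_ge0.
- by rewrite hypot_ge0// mulr_ge0.
by rewrite sqr_hypot ?mulr_ge0// [(c * hypot _ _) ^+ 2]exprMn sqr_hypot// !exprMn mulrDr.
Qed.

Lemma ler_hypot a b c d : 0 <= a -> 0 <= b -> a <= c -> b <= d ->
  hypot a b <= hypot c d.
Proof.
move=> a0 b0 ac bd; have c0 := le_trans a0 ac; have d0 := le_trans b0 bd.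
rewrite -(@ler_pXn2r _ 2) ?nnegrE ?hypot_ge0// !sqr_hypot// lerD//.
- by rewrite ler_pXn2r.
- by rewrite ler_pXn2r.
Qed.

Lemma hypotD a b c d : 0 <= a -> 0 <= b -> 0 <= c -> 0 <= d ->
  hypot (a + c) (b + d) <= hypot a b + hypot c d.
Proof.
move=> a0 b0 c0 d0.
have CS : a * c + b * d <= hypot a b * hypot c d.
  rewrite -(@ler_pXn2r _ 2) ?nnegrE ?addr_ge0 ?mulr_ge0 ?hypot_ge0//.
  rewrite [leRHS]exprMn !sqr_hypot// -subr_ge0.
  have -> : (a ^+ 2 + b ^+ 2) * (c ^+ 2 + d ^+ 2) - (a * c + b * d) ^+ 2
     = (a * d - b * c) ^+ 2 by ring.
  by rewrite real_exprn_even_ge0// rpredB// ger0_real// mulr_ge0.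
rewrite -(@ler_pXn2r _ 2) ?nnegrE ?addr_ge0 ?hypot_ge0// ?addr_ge0//.
rewrite sqr_hypot ?addr_ge0// [leRHS]sqrrD !sqr_hypot//.
have -> : (a + c) ^+ 2 + (b + d) ^+ 2 =
   a ^+ 2 + b ^+ 2 + (a * c + b * d) *+ 2 + (c ^+ 2 + d ^+ 2) by ring.
by rewrite lerD2r lerD2l lerMn2r CS orbT.
Qed.

End Hypot.

Section ContinuousFields.
Variables (X : topologicalType) (K : numFieldType).
Implicit Types E F : X -> normedModType K.

(* This is the axiom cauchy_cvg of completeType, as a predicate. *)
Definition banach (V : normedModType K) : Prop :=
  forall F : set_system V, ProperFilter F -> cauchy F -> cvg F.

Definition linear_subspace E (C : set (forall x, E x)) : Prop :=
  C (fun=> 0) /\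
  forall (a : K) (f g : forall x, E x), C f -> C g ->
    C (fun x => a *: f x + g x).

Definition locally_uniformly_closed E (C : set (forall x, E x)) : Prop :=
  forall g : forall x, E x,
    (forall (x : X) (e : K), 0 < e ->
       exists2 f, C f & \forall y \near x, `|g y - f y| <= e) ->
    C g.

Definition saturated E (C : set (forall x, E x)) : Prop :=
  forall (x : X) (z : E x), exists2 f, C f & f x = z.

Definition continuous_field E (C : set (forall x, E x)) : Prop :=
  [/\ forall x, banach (E x),
      linear_subspace C,
      forall f, C f -> continuous (fun x => `|f x| : K),
      locally_uniformly_closed C
    & saturated C].

(* The sections of bounded operators belonging to C^s(E, F). *)
Definition strongly_continuous E (CE : set (forall x, E x))
    F (CF : set (forall x, F x)) (S : forall x, {linear E x -> F x}) : Prop :=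
  (forall x, exists M : K, forall z : E x, `|S x z| <= M * `|z|) /\
  forall f, CE f -> CF (fun x => S x (f x)).

End ContinuousFields.

Section Submodule.
Variables (K : numFieldType) (V : lmodType K) (S : submodClosed V).

Record submodule : Type :=
  Submodule { submodule_val : V; _ : submodule_val \in S }.

HB.instance Definition _ := [isSub for submodule_val].
HB.instance Definition _ := [Choice of submodule by <:].
HB.instance Definition _ := [SubChoice_isSubLmodule of submodule by <:].

End Submodule.

Section ClosedOperators.
Variables (k : scalars) (V W : normedModType k).

Definition graph (D : submodClosed V) (t : submodule D -> W) : set (V * W) :=
  [set p | exists z : submodule D, p = (val z, t z)].

(* The domain is not required to be dense. *)
Record closed_operator : Type := ClosedOperator {
  dom : submodClosed V;
  op : {linear submodule dom -> W};
  op_closed : closed (graph op)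
}.

Variable T : closed_operator.

Definition graph_pred : {pred V * W} := fun p => `[< graph (op T) p >].

Lemma graph_pred_submod_closed : submod_closed graph_pred.
Proof.
split=> [|a u v /asboolP[y ->] /asboolP[z ->]]; apply/asboolP.
  by exists 0; rewrite !linear0.
by exists (a *: y + z); rewrite !linearP.
Qed.

HB.instance Definition _ := GRing.isSubmodClosed.Build k (V * W)%type graph_pred
  graph_pred_submod_closed.

Definition domain_fiber : Type := submodule (dom T).
HB.instance Definition _ := GRing.Lmodule.on domain_fiber.

Definition graph_norm (z : domain_fiber) : k :=
  hypot `|val z : V| `|op T z|.

Lemma graph_normD y z : graph_norm (y + z) <= graph_norm y + graph_norm z.
Proof.
rewrite /graph_norm !linearD (le_trans _ (hypotD _ _ _ _))//.
by rewrite ler_hypot// ler_normD.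
Qed.

Lemma graph_normZ (a : k) z : graph_norm (a *: z) = `|a| * graph_norm z.
Proof. by rewrite /graph_norm !linearZ !normrZ hypotM. Qed.

Lemma graph_norm_eq0 z : graph_norm z = 0 -> z = 0.
Proof.
by move=> /hypot_eq0[]// /normr0_eq0 z0 _; apply: val_inj; rewrite z0 linear0.
Qed.

HB.instance Definition _ := Lmodule_isNormed.Build k domain_fiber
  graph_normD graph_normZ graph_norm_eq0.

Definition flat (z : domain_fiber) : W := op T z.

Lemma flat_is_linear : linear flat.
Proof. by move=> a y z; rewrite /flat linearP. Qed.

HB.instance Definition _ := GRing.isLinear.Build k domain_fiber W *:%R flat
  flat_is_linear.

Definition graph_fiber : Type := submodule graph_pred.
HB.instance Definition _ := GRing.Lmodule.on graph_fiber.

(* The library's norm on V * W is the maximum norm. *)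
Definition euclidean_norm (p : graph_fiber) : k :=
  hypot `|(val p).1| `|(val p).2|.

Lemma euclidean_normD p q :
  euclidean_norm (p + q) <= euclidean_norm p + euclidean_norm q.
Proof.
rewrite /euclidean_norm (le_trans _ (hypotD _ _ _ _))//.
by rewrite ler_hypot// linearD ler_normD.
Qed.

Lemma euclidean_normZ (a : k) p :
  euclidean_norm (a *: p) = `|a| * euclidean_norm p.
Proof. by rewrite /euclidean_norm linearZ !normrZ hypotM. Qed.

Lemma euclidean_norm_eq0 p : euclidean_norm p = 0 -> p = 0.
Proof.
move=> /hypot_eq0[]// /normr0_eq0 p1 /normr0_eq0 p2; apply: val_inj.
by rewrite linear0; case: (val p) p1 p2 => ? ? /= -> ->.
Qed.

HB.instance Definition _ := Lmodule_isNormed.Build k graph_fiber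
  euclidean_normD euclidean_normZ euclidean_norm_eq0.

End ClosedOperators.

Section SectionsOfClosedOperators.
Variables (X : topologicalType) (k : scalars) (E F : X -> normedModType k).
Variables (CE : set (forall x, E x)) (CF : set (forall x, F x)).
Variable T : forall x, closed_operator (E x) (F x).

Definition domain_field (x : X) : normedModType k := domain_fiber (T x).

(* That f x lies in D(T_x) is part of the type of f. *)
Definition domain_sections : set (forall x, domain_field x) :=
  [set f | CE (fun x => val (f x)) /\ CF (fun x => op (T x) (f x))].

Definition flat_section (x : X) : {linear domain_field x -> F x} :=
  @flat k (E x) (F x) (T x).

Definition graph_field (x : X) : normedModType k := graph_fiber (T x).

Definition graph_sections : set (forall x, graph_field x) :=
  [set s | CE (fun x => (val (s x)).1) /\ CF (fun x => (val (s x)).2)].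

Definition G_continuous : Prop :=
  forall (x : X) (z : domain_field x), exists2 f, domain_sections f & f x = z.

End SectionsOfClosedOperators.

Arguments domain_sections {X k E F} CE CF T _.
Arguments graph_sections {X k E F} CE CF T _.
Arguments G_continuous {X k E F} CE CF T.

(* Main.v *)
(* The maps z |-> (z, T z) and (z, T z) |-> (z, T z) embed the fibers of D(T)
   and of G(T) linearly onto the closed graph of T, and the norm of either
   fiber is the hypotenuse of the norms of the two components.  For such an
   embedding into the sum of two continuous fields, completeness, continuity of
   the norm and local uniform closedness are inherited componentwise; only
   saturation can fail, and saturation of D(T) or of G(T) is G-continuity. *)
Require Import Defs.
From HB Require Import structures.
From mathcomp Require Import all_boot all_order all_algebra.
From mathcomp Require Import all_classical all_reals all_analysis.

Set Implicit Arguments.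
Unset Strict Implicit.
Unset Printing Implicit Defensive.

Import Order.TTheory GRing.Theory Num.Theory.
Import numFieldNormedType.Exports.

Local Open Scope classical_set_scope.
Local Open Scope ring_scope.

Section Hypot.
Variable k : scalars.
Implicit Types a b c d : k.

(** Squared, the two sides differ by the cross term [2ab]. Through this bound, convergence of both
    components gives convergence in the hypotenuse norm; the next two bounds make each component a
    contraction. *)
Lemma hypot_leD a b : 0 <= a -> 0 <= b -> hypot a b <= a + b.
Proof.
move=> a0 b0; rewrite -(@ler_pXn2r _ 2) ?nnegrE ?addr_ge0 ?hypot_ge0//.
by rewrite sqr_hypot// sqrrD lerD2r lerDl mulrn_wge0 ?mulr_ge0.
Qed.

Lemma ler_hypotl a b : 0 <= a -> 0 <= b -> a <= hypot a b.
Proof.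
move=> a0 b0; rewrite -(@ler_pXn2r _ 2) ?nnegrE ?hypot_ge0//.
by rewrite sqr_hypot// lerDl exprn_ge0.
Qed.

Lemma ler_hypotr a b : 0 <= a -> 0 <= b -> b <= hypot a b.
Proof.
move=> a0 b0; rewrite -(@ler_pXn2r _ 2) ?nnegrE ?hypot_ge0//.
by rewrite sqr_hypot// lerDr exprn_ge0.
Qed.

(** [hypot] is monotone and subadditive: enlarging [c] and [d] by the distances to [a] and [b] gives
    one half of the bound, and exchanging the pairs gives the other. *)
Lemma hypot_lipschitz a b c d : 0 <= a -> 0 <= b -> 0 <= c -> 0 <= d ->
  `|hypot a b - hypot c d| <= `|a - c| + `|b - d|.
Proof.
have ler_add_dist x y : 0 <= x -> 0 <= y -> x <= y + `|x - y|.
  (* The order of [R[i]] is only partial, so the difference must be shown real: it is a difference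
     of nonnegative scalars. *)
  by move=> x0 y0; rewrite -lerBlDl real_ler_norm// rpredB// ger0_real.
have le_hypotD a' b' c' d' : 0 <= a' -> 0 <= b' -> 0 <= c' -> 0 <= d' ->
    hypot a' b' <= hypot c' d' + (`|a' - c'| + `|b' - d'|).
  move=> a0 b0 c0 d0.
  rewrite (@le_trans _ _ (hypot (c' + `|a' - c'|) (d' + `|b' - d'|)))//.
    by rewrite ler_hypot// ler_add_dist.
  by rewrite (le_trans (hypotD _ _ _ _))// lerD2l hypot_leD.
move=> a0 b0 c0 d0; rewrite real_ler_norml ?rpredB ?ger0_real ?hypot_ge0//.
rewrite lerBlDl le_hypotD// andbT lerNl opprB lerBlDl.
by rewrite (distrC a) (distrC b) le_hypotD.
Qed.

Lemma continuous_hypot (X : topologicalType) (f g : X -> k) :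
  (forall x, 0 <= f x) -> (forall x, 0 <= g x) ->
  continuous f -> continuous g -> continuous (fun x => hypot (f x) (g x)).
Proof.
move=> f0 g0 cf cg x; apply/cvgrPdist_lt => e e0.
have e2 : 0 < e / 2 by rewrite divr_gt0.
have /cvgrPdist_lt/(_ _ e2) fx := cf x.
have /cvgrPdist_lt/(_ _ e2) gx := cg x.
near=> y; rewrite (le_lt_trans (hypot_lipschitz _ _ _ _))// (splitr e) ltrD//.
- by near: y.
- by near: y.
Unshelve. all: by end_near.
Qed.

End Hypot.

Lemma cauchy_contraction (K : numFieldType) (U V : normedModType K)
    (p : {linear U -> V}) (F : set_system U) :
  (forall z, `|p z| <= `|z|) -> ProperFilter F -> cauchy F -> cauchy (p @ F).
Proof.
move=> ple FF /cauchy_ballP cF; apply/cauchy_ballP => e e0.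
have [[A B] /= [FA FB] AB] := cF e e0.
exists (p @` A, p @` B) => /=.
  by split; [apply: filterS FA | apply: filterS FB] => z; exists z.
move=> [_ _] /= [[y Ay <-] [z Bz <-]].
have := AB (y, z) (conj Ay Bz); rewrite -!ball_normE /= -linearB.
exact: le_lt_trans.
Qed.

(** Both components of a Cauchy filter are Cauchy, hence converge. Closedness puts the pair of
    limits in the range, say at [(p z, q z)], and the filter then tends to [z]. *)
Lemma banach_closed_range (k : scalars) (U V W : normedModType k)
    (p : {linear U -> V}) (q : {linear U -> W}) :
  (forall z, `|z| = hypot `|p z| `|q z|) ->
  closed (range (fun z => (p z, q z))) ->
  banach V -> banach W -> banach U.
Proof.
move=> normpq closedpq bV bW F FF cF.
have /bV pF : cauchy (p @ F).
  by apply: cauchy_contraction => // z; rewrite normpq ler_hypotl.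
have /bW qF : cauchy (q @ F).
  by apply: cauchy_contraction => // z; rewrite normpq ler_hypotr.
have [z _ [pz qz]] :
    range (fun z => (p z, q z)) (lim (p @ F), lim (q @ F)).
  apply: (@closed_cvg _ _ F FF _ _ closedpq); last exact: cvg_pair pF qF.
  by apply: filterE => z; exists z.
apply: (cvgP z); apply/cvgrPdist_lt => e e0.
have e2 : 0 < e / 2 by rewrite divr_gt0.
move: pF => /cvgrPdist_lt/(_ _ e2) pF; move: qF => /cvgrPdist_lt/(_ _ e2) qF.
near=> y; rewrite normpq (le_lt_trans (hypot_leD _ _))//.
rewrite (splitr e) !linearB ltrD// ?pz ?qz.
- by near: y.
- by near: y.
Unshelve. all: by end_near.
Qed.

Section PullbackField.
Variables (X : topologicalType) (k : scalars) (E F H : X -> normedModType k).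
Variables (CE : set (forall x, E x)) (CF : set (forall x, F x)).
Variables (p : forall x, {linear H x -> E x}).
Variables (q : forall x, {linear H x -> F x}).
Arguments p : clear implicits.
Arguments q : clear implicits.

(** Unfolds to [domain_sections] when [p] is the inclusion and [q] the operator, and to
    [graph_sections] when they are the coordinates. *)
Definition pullback_sections : set (forall x, H x) :=
  [set s | CE (fun x => p x (s x)) /\ CF (fun x => q x (s x))].

Hypothesis normpq : forall x (z : H x), `|z| = hypot `|p x z| `|q x z|.
Hypothesis closedpq : forall x, closed (range (fun z => (p x z, q x z))).

Lemma continuous_field_pullback : continuous_field CE -> continuous_field CF ->
  saturated pullback_sections -> continuous_field pullback_sections.
Proof.
move=> [bE [CE0 CED] nE clE _] [bF [CF0 CFD] nF clF _] sat; split => //.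
- by move=> x; apply: (banach_closed_range (normpq (x := x))).
- split; first split.
  + congr (CE _): CE0.
    by apply: functional_extensionality_dep => x; rewrite linear0.
  + congr (CF _): CF0.
    by apply: functional_extensionality_dep => x; rewrite linear0.
  move=> a f g [fE fF] [gE gF]; split.
  + have := CED a _ _ fE gE; congr (CE _).
    by apply: functional_extensionality_dep => x; rewrite linearP.
  + have := CFD a _ _ fF gF; congr (CF _).
    by apply: functional_extensionality_dep => x; rewrite linearP.
- move=> f [/nE fE /nF fF].
  rewrite (_ : (fun x => _) = fun x => hypot `|p x (f x)| `|q x (f x)|).
    exact: continuous_hypot.
  by apply/funext => x.
- move=> g gapprox; split; [apply: clE | apply: clF] => x e e0.
  + have [f [fE _] gf] := gapprox x e e0.
    exists (fun x => p x (f x)) => //; apply: filterS gf => y.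
    by apply: le_trans; rewrite -linearB normpq ler_hypotl.
  + have [f [_ fF] gf] := gapprox x e e0.
    exists (fun x => q x (f x)) => //; apply: filterS gf => y.
    by apply: le_trans; rewrite -linearB normpq ler_hypotr.
Qed.

End PullbackField.

Section ClosedOperator.
Variables (k : scalars) (V W : normedModType k) (T : closed_operator V W).

(** A separate name for [val] on the space with the graph norm, to which a linear structure can be
    attached. *)
Definition domain_incl (z : domain_fiber T) : V := val z.

Lemma domain_incl_is_linear : linear domain_incl.
Proof. by move=> a y z; rewrite /domain_incl linearP. Qed.

HB.instance Definition _ := GRing.isLinear.Build k (domain_fiber T) V *:%R
  domain_incl domain_incl_is_linear.

Definition graph_fst (z : graph_fiber T) : V := (val z).1.

Lemma graph_fst_is_linear : linear graph_fst.
Proof. by move=> a y z; rewrite /graph_fst linearP. Qed.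

HB.instance Definition _ := GRing.isLinear.Build k (graph_fiber T) V *:%R
  graph_fst graph_fst_is_linear.

Definition graph_snd (z : graph_fiber T) : W := (val z).2.

Lemma graph_snd_is_linear : linear graph_snd.
Proof. by move=> a y z; rewrite /graph_snd linearP. Qed.

HB.instance Definition _ := GRing.isLinear.Build k (graph_fiber T) W *:%R
  graph_snd graph_snd_is_linear.

Lemma closed_range_domain_fiber :
  closed (range (fun z : domain_fiber T => (domain_incl z, flat z))).
Proof.
rewrite (_ : range _ = graph (op T)); first exact: op_closed.
by apply/seteqP; split => [_ [z _ <-]|_ [z ->]]; exists z.
Qed.

Lemma graph_fiberP (z : graph_fiber T) :
  exists y : domain_fiber T, val z = (domain_incl y, flat y).
Proof. by case: z => u /= /asboolP[y ->]; exists y. Qed.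

Definition graph_of (z : domain_fiber T) : graph_fiber T :=
  @Submodule _ _ (graph_pred T) (val z, op T z) (asboolT (ex_intro _ z erefl)).

Lemma closed_range_graph_fiber :
  closed (range (fun z : graph_fiber T => (graph_fst z, graph_snd z))).
Proof.
rewrite (_ : range _ = graph (op T)); first exact: op_closed.
apply/seteqP; split => [_ [z _ <-]|_ [z ->]].
  have [y zy] := graph_fiberP z.
  by exists y; rewrite /graph_fst /graph_snd zy.
by exists (graph_of z).
Qed.

End ClosedOperator.

Section SectionsOfClosedOperators.
Variables (X : topologicalType) (k : scalars) (E F : X -> normedModType k).
Variables (CE : set (forall x, E x)) (CF : set (forall x, F x)).
Variable T : forall x, closed_operator (E x) (F x).

(** Sections of D(T) and of G(T) correspond fiberwise: [graph_of] turns the former into the latter,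
    and first coordinates lead back. *)
Lemma G_continuous_graphP :
  G_continuous CE CF T <-> saturated (graph_sections CE CF T).
Proof.
split=> [gT x z|sat x z].
  have [y zy] := graph_fiberP z; have [f Cf fx] := gT x y.
  exists (fun x => graph_of (f x)) => //.
  by apply: val_inj; rewrite /= fx zy.
have [s [sE sF] sx] := sat x (graph_of z).
(* Choice selects, at every point, an element of the domain over which [s] lies. *)
have [f fs] : {f : forall x, domain_field T x &
    forall x, val (s x) = (domain_incl (f x), flat (f x))}.
  exists (fun x => projT1 (cid (graph_fiberP (s x)))) => y.
  exact: projT2 (cid (graph_fiberP (s y))).
exists f; first split.
- by congr (CE _): sE; apply: functional_extensionality_dep => y; rewrite fs.
- by congr (CF _): sF; apply: functional_extensionality_dep => y; rewrite fs.
(* A point of the graph determines its domain element by the first coordinate, so the selected [f x]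
   must be [z]. *)
by apply: val_inj; have := congr1 fst (fs x); rewrite sx.
Qed.

Hypotheses (hE : continuous_field CE) (hF : continuous_field CF).

(** [G_continuous] is by conversion the saturation of [domain_sections]; the other axioms come from
    the pullback. *)
Lemma continuous_field_domainP :
  continuous_field (domain_sections CE CF T) <-> G_continuous CE CF T.
Proof.
split=> [[]//|gT].
apply: (@continuous_field_pullback _ _ _ _ (domain_field T) CE CF
  (fun x => @domain_incl _ _ _ (T x)) (fun x => @flat _ _ _ (T x))) => //.
by move=> x; exact: closed_range_domain_fiber.
Qed.

Lemma continuous_field_graphP :
  continuous_field (graph_sections CE CF T) <-> G_continuous CE CF T.
Proof.
split=> [[_ _ _ _]|] /G_continuous_graphP// gT.
apply: (@continuous_field_pullback _ _ _ _ (graph_field T) CE CF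
  (fun x => @graph_fst _ _ _ (T x)) (fun x => @graph_snd _ _ _ (T x))) => //.
by move=> x; exact: closed_range_graph_fiber.
Qed.

Lemma strongly_continuous_flat :
  strongly_continuous (domain_sections CE CF T) CF (flat_section T).
Proof.
split=> [x|f []//].
(* The bound 1 works because the norm of [T z] is one leg of the hypotenuse defining the graph
   norm. *)
by exists 1 => z; rewrite mul1r ler_hypotr.
Qed.

End SectionsOfClosedOperators.

Theorem theorem5p4 (k : scalars) (X : topologicalType)
    (E F : X -> normedModType k)
    (CE : set (forall x, E x)) (CF : set (forall x, F x))
    (hE : continuous_field CE) (hF : continuous_field CF)
    (T : forall x, closed_operator (E x) (F x)) :
  (G_continuous CE CF T <->
     continuous_field (domain_sections CE CF T) /\
     strongly_continuous (domain_sections CE CF T) CF (flat_section T)) /\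
  (G_continuous CE CF T <-> continuous_field (graph_sections CE CF T)).
Proof.
split; last by rewrite continuous_field_graphP.
(* Strong continuity of [flat_section T] always holds, so (ii) reduces to its first half. *)
rewrite continuous_field_domainP//; split=> [gT|[]//].
by split=> //; exact: strongly_continuous_flat.
Qed.
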